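(* Let $\theta$ be a transcendental real number, $n\ge2$ an integer, and $(P_j)_{j\ge1}$ the best approximation polynomials associated to $\theta,n$. Let $k$ be a sufficiently large index such that $P_k$ and $P_{k+1}$ are coprime, and put \[\nu_k=-\frac{\log|P_k(\theta)|}{\log H(P_k)},\quad \nu_{k+1}=-\frac{\log|P_{k+1}(\theta)|}{\log H(P_{k+1})},\quad \tau_{k+1}=\frac{\log H(P_{k+2})}{\log H(P_{k+1})},\quad \chi_k=\frac{\nu_k-n+1}{n}.\] Assume $\nu_k>2n-1$ and that either \[(\chi_k^2\nu_{k+1}-\chi_k\nu_k)\widehat w_n(\theta)^2-\nu_k\widehat w_n(\theta)-\chi_k\nu_k\nu_{k+1}>0\] or \[(\nu_{k+1}-\tau_{k+1})\frac{\nu_k-n+1}{\nu_k}>n.\] Then $P_k,P_{k+1},P_{k+2}$ are linearly independent.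
   Context: For a nonzero integer polynomial $P$, $H(P)$ is its height (maximum absolute value of its coefficients). $\widehat w_n(\theta)$ is the supremum of $\widehat w$ such that for every sufficiently large $X$ there is a nonzero integer polynomial $P$ of degree at most $n$ with $H(P)\le X$ and $0<|P(\theta)|<X^{-\widehat w}$. The best approximation polynomials associated to $\theta,n$ are the (assumed unique up to sign) nonzero integer polynomials $P_k$ of degree at most $n$ with $H(P_1)<H(P_2)<\cdots$ such that $|P_k(\theta)|>0$ is minimal among $|P(\theta)|$ over nonzero integer polynomials $P$ of degree $\le n$ with $H(P)<H(P_{k+1})$. *)

(* Defs.v *)
From HB Require Import structures.
From mathcomp Require Import all_boot all_order all_algebra.
From mathcomp Require Import all_classical all_reals all_analysis.
Set Implicit Arguments.
Unset Strict Implicit.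
Unset Printing Implicit Defensive.
Import Order.TTheory GRing.Theory Num.Theory.
Import numFieldNormedType.Exports.
Local Open Scope classical_set_scope.
Local Open Scope ring_scope.

Definition height (p : {poly int}) : nat := (\max_(i < size p) `|(p`_i)%R|)%N.

Definition evalz (R : realType) (p : {poly int}) (x : R) : R :=
  (map_poly intr p).[x].

Definition transcendental (R : realType) (x : R) : Prop :=
  ~ algebraicOver (ratr : rat -> R) x.

Definition intpoly (n : nat) : set {poly int} :=
  [set p : {poly int} | p != 0 /\ (size p <= n.+1)%N].

(* The supremum is real-valued: for transcendental [x] and [1 <= n] the set
   contains 0 and is bounded above by 2n - 1 (Davenport-Schmidt), so [sup] does
   not take its default value. *)
Definition what (R : realType) (n : nat) (x : R) : R :=
  sup [set w : R | \forall X \near +oo, exists p : {poly int},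
    [/\ intpoly n p, (height p)%:R <= X & 0 < `|evalz p x| < X `^ (- w)]].

(* The sequence is indexed from 1; the value [P 0] is irrelevant. *)
Definition best_approximations (R : realType) (x : R) (n : nat)
    (P : nat -> {poly int}) : Prop :=
  forall k, (0 < k)%N ->
    [/\ intpoly n (P k),
        (height (P k) < height (P k.+1))%N,
        0 < `|evalz (P k) x|,
        forall q, intpoly n q -> (height q < height (P k.+1))%N ->
          `|evalz (P k) x| <= `|evalz q x|
      & forall q, intpoly n q -> (height q < height (P k.+1))%N ->
          `|evalz q x| = `|evalz (P k) x| -> q = P k \/ q = - P k].

Definition ratpoly (p : {poly int}) : {poly rat} := map_poly intr p.

Definition linearly_independent (F : fieldType) (V : lmodType F) (m : nat)
    (v : 'I_m -> V) : Prop :=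
  forall a : 'I_m -> F, \sum_(i < m) a i *: v i = 0 -> forall i, a i = 0.

Definition nu (R : realType) (x : R) (p : {poly int}) : R :=
  - (ln `|evalz p x| / ln (height p)%:R).

Definition tau (R : realType) (P : nat -> {poly int}) (k : nat) : R :=
  ln (height (P k.+1))%:R / ln (height (P k))%:R.

(* Main.v *)
(** Write [L_k = |P_k(theta)|] and [H_k] for the height of [P_k]. If [P_k],
    [P_(k+1)], [P_(k+2)] are dependent, then consecutive pairs are bases of one
    rank two lattice, so [P_k = b P_(k+1) +- P_(k+2)]; comparing heights and
    values gives [L_k H_(k+1) <= 3 L_(k+1) H_(k+2)], that is,
    [nu_(k+1) - tau_(k+1) <= nu_k / tau_k - 1 + o(1)]. Coprimality of [P_k] and
    [P_(k+1)] bounds their resultant from below by 1, which yields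
    [1 << L_k H_k^(n-1) H_(k+1)^n], that is, [tau_k >= chi_k - o(1)]. These two
    bounds contradict the second condition. For the first one, the definition
    of the uniform exponent [w] adds [tau_(k+1) <= nu_(k+1) / w + o(1)], hence
    [nu_(k+1) (1 - 1/w) <= nu_k / chi_k - 1 + o(1)], whereas with
    [r = nu_k / chi_k >= n] the condition forces
    [nu_(k+1) (1 - 1/w) > r - 1 + 1/w^2]. *)
Require Import Defs.
From HB Require Import structures.
From mathcomp Require Import all_boot all_order all_fingroup all_algebra.
From mathcomp Require Import all_classical all_reals all_analysis.
From mathcomp Require Import zify ring lra.
Import Order.TTheory GRing.Theory Num.Theory.
Import numFieldNormedType.Exports.
Local Open Scope classical_set_scope.
Local Open Scope ring_scope.

(** * Determinants whose entries are bounded row by row *)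

Lemma norm_det_le_prod (R : numDomainType) (m : nat) (A : 'M[R]_m)
    (b : 'I_m -> R) :
  (forall i j, `|A i j| <= b i) -> `|\det A| <= m`!%:R * \prod_i b i.
Proof.
move=> hA; rewrite /determinant (le_trans (ler_norm_sum _ _ _))//.
have -> : m`!%:R * \prod_i b i = \sum_(s : 'S_m) \prod_i b i :> R.
  by rewrite sumr_const cardT -cardE card_Sn mulr_natl.
apply: ler_sum => s _; rewrite normrM normrX normrN1 expr1n mul1r normr_prod.
by apply: ler_prod => i _; rewrite normr_ge0 hA.
Qed.

(** Deleting row [i] loses the factor [b i], which the left-hand side restores. This form avoids
    dividing by [b i], which may vanish. *)
Lemma norm_cofactor_le_prod (R : numDomainType) (m : nat) (A : 'M[R]_m)
    (b : 'I_m -> R) (i j : 'I_m) :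
  (forall i j, `|A i j| <= b i) -> (forall i, 0 <= b i) ->
  b i * `|cofactor A i j| <= m`!%:R * \prod_k b k.
Proof.
move=> hA b0; rewrite /cofactor normrM normrX normrN1 expr1n mul1r.
rewrite (bigD1_ord i)//= mulrCA ler_wpM2l//.
apply: (@le_trans _ _ ((m.-1)`!%:R * \prod_(k < m.-1) b (lift i k))).
  by apply: norm_det_le_prod => k l; rewrite !mxE.
apply: ler_wpM2r; first by apply: prodr_ge0 => k _.
rewrite ler_nat; have [->//|m0] := posnP m.
by rewrite -[in leqRHS](prednK m0) factS leq_pmull.
Qed.

(* Cramer's rule: with [v j 0 = 1], the determinant is the [j]-th entry of
   [\adj A *m (A *m v)]. *)
Lemma norm_det_le_mulmx (R : numDomainType) (m : nat) (A : 'M[R]_m)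
    (b : 'I_m -> R) (v : 'cV[R]_m) (j : 'I_m) (t : R) :
  (forall i j, `|A i j| <= b i) -> (forall i, 0 <= b i) -> v j 0 = 1 ->
  (forall i, `|(A *m v) i 0| <= t * b i) ->
  `|\det A| <= t * (m * m`!)%:R * \prod_i b i.
Proof.
move=> hA b0 vj hv.
have -> : \det A = (\adj A *m (A *m v)) j 0.
  by rewrite mulmxA mul_adj_mx mul_scalar_mx mxE vj mulr1.
rewrite mxE (le_trans (ler_norm_sum _ _ _))//.
have -> : t * (m * m`!)%:R * \prod_i b i =
    \sum_(i < m) t * (m`!%:R * \prod_i b i) :> R.
  by rewrite sumr_const card_ord -mulr_natl natrM; ring.
apply: ler_sum => i _; rewrite normrM mxE.
have t0 : t * b i \is Num.nneg by rewrite nnegrE (le_trans _ (hv i)).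
apply: (@le_trans _ _ (`|cofactor A i j| * (t * b i))).
  by rewrite ler_wpM2l.
(* If [b i = 0] both sides vanish; otherwise [0 <= t * b i] yields [0 <= t]. *)
have [bi0|bi0] := eqVneq (b i) 0.
  by rewrite bi0 !mulr0 (bigD1 i)//= bi0 mul0r !mulr0 lexx.
have tge : 0 <= t.
  have bp : 0 < b i by rewrite lt_def bi0 b0.
  by rewrite -(pmulr_lge0 _ bp) -nnegrE.
rewrite mulrCA ler_wpM2l// mulrC.
exact: norm_cofactor_le_prod.
Qed.

(** * Resultants, heights and values of integer polynomials *)

(** Injectivity preserves degrees, hence the shape of the Sylvester matrix. *)
Lemma resultant_map_inj (aR rR : nzRingType) (f : {rmorphism aR -> rR})
    (p q : {poly aR}) : injective f ->
  resultant (map_poly f p) (map_poly f q) = f (resultant p q).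
Proof.
move=> finj; rewrite /resultant /Sylvester_mx !size_map_inj_poly ?rmorph0//.
rewrite -det_map_mx /= map_col_mx; congr (\det (col_mx _ _));
  by apply/esym/map_lin1_mx => v; rewrite /= map_poly_rV rmorphM /= map_rVpoly.
Qed.

Lemma leq_coef_height (p : {poly int}) (i : nat) : (`|(p`_i)%R| <= height p)%N.
Proof.
have [ip|pi] := ltnP i (size p); last by rewrite nth_default.
exact: (@leq_bigmax _ (fun i : 'I_(size p) => `|(p`_i)%R|%N) (Ordinal ip)).
Qed.

Lemma height_attained (p : {poly int}) :
  p != 0 -> exists i, height p = `|(p`_i)%R|%N.
Proof.
rewrite -size_poly_gt0 => p0; rewrite /height (bigop.bigmax_eq_arg (Ordinal p0))//.
by eexists.
Qed.

Lemma height_gt0 (p : {poly int}) : p != 0 -> (0 < height p)%N.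
Proof.
move=> p0; apply: leq_trans (leq_coef_height p (size p).-1).
by rewrite absz_gt0 -lead_coefE lead_coef_eq0.
Qed.

Lemma height_lt (p : {poly int}) (m : nat) :
  (0 < m)%N -> (forall i, (`|(p`_i)%R| < m)%N) -> (height p < m)%N.
Proof.
move=> m0 hp; have [->|p0] := eqVneq p 0.
  by rewrite /height size_poly0 big_ord0.
by have [i ->] := height_attained _ p0.
Qed.

Lemma evalzD (R : realType) (p q : {poly int}) (x : R) :
  evalz (p + q) x = evalz p x + evalz q x.
Proof. by rewrite /evalz rmorphD hornerD. Qed.

Lemma evalzZ (R : realType) (a : int) (p : {poly int}) (x : R) :
  evalz (a *: p) x = a%:~R * evalz p x.
Proof. by rewrite /evalz map_polyZ hornerZ. Qed.

Lemma evalz_const (R : realType) (p : {poly int}) (x : R) :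
  (size p <= 1)%N -> `|evalz p x| = (height p)%:R.
Proof.
move=> /size1_polyC ->; rewrite /evalz map_polyC hornerC/=.
have [->|p0] := eqVneq p`_0 0; first by rewrite normr0 /height size_poly0 big_ord0.
rewrite /height size_polyC p0 big_ord1 coefC eqxx.
by rewrite -intr_norm -abszE.
Qed.

Lemma resultant_neq0_of_coprimep (p q : {poly int}) :
  coprimep (ratpoly p) (ratpoly q) -> resultant p q != 0.
Proof.
move=> /coprimep_size_gcd h.
have : resultant (ratpoly p) (ratpoly q) != 0 by rewrite resultant_eq0 h.
by rewrite /ratpoly resultant_map_inj ?intr_eq0//; apply: intr_inj.
Qed.

(** The rows are the coefficients of the [p * 'X^k] and [q * 'X^k], so multiplying by the powers of
    [x] evaluates these products. *)
Lemma Sylvester_mx_powers (R : comNzRingType) (p q : {poly R}) (x : R) i :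
  (Sylvester_mx p q *m \col_j x ^+ j) i 0 =
  match fintype.split i with
  | inl k => p.[x] * x ^+ k | inr k => q.[x] * x ^+ k
  end.
Proof.
rewrite mxE; under eq_bigr do rewrite Sylvester_mxE mxE.
have E (r : {poly R}) (k m : nat) : ((size r).-1 + k < m)%N ->
    \sum_(j < m) r`_(j - k) *+ (k <= j) * x ^+ j = r.[x] * x ^+ k.
  move=> hm; rewrite -hornerXn -hornerM (@horner_coef_wide _ m).
    by apply: eq_bigr => j _; rewrite coefMXn ltnNge if_neg mulrb.
  rewrite (leq_trans (size_polyMleq _ _))// size_polyXn addnS /=.
  case: (size r) hm => [|s]; [exact: ltnW | by rewrite addSn].
case: splitP => k ik.
  apply: E; rewrite addnC; have := ltn_ord k.
  by rewrite -(ltn_add2r (size p).-1).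
apply: E; rewrite ltn_add2l; exact: ltn_ord.
Qed.

(** The resultant is a nonzero integer. In its Sylvester matrix the rows are bounded by the heights,
    and the vector of powers of [x] maps each row to at most [T * Lp / Hp] times its bound: for the
    rows of [q] because its value is no larger and its height no smaller than that of [p]. Dividing
    by [Hp] lowers the exponent of [Hp] to [n - 1]. *)
Lemma resultant_lower_bound (R : realType) (x : R) (n : nat)
    (p q : {poly int}) :
  (0 < n)%N -> intpoly n p -> intpoly n q -> coprimep (ratpoly p) (ratpoly q) ->
  (height p <= height q)%N -> `|evalz q x| <= `|evalz p x| ->
  1 <= (n + n)%:R * ((n + n)`!)%:R * (1 + `|x|) ^+ n *
    (`|evalz p x| * (height p)%:R ^+ n.-1 * (height q)%:R ^+ n).
Proof.
move=> n0 [p0 szp] [q0 szq] cpq hpq lqp.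
set Hp : R := (height p)%:R; set Hq : R := (height q)%:R.
set Lp := `|evalz p x|; set T := (1 + `|x|) ^+ n.
have Hp1 : 1 <= Hp by rewrite ler1n height_gt0.
have Hpq : Hp <= Hq by rewrite ler_nat.
have Hq1 : 1 <= Hq := le_trans Hp1 Hpq.
have T1 : 1 <= T by rewrite exprn_ege1// lerDl.
have Lp0 : 0 <= Lp by rewrite normr_ge0.
set F : R := (n + n)%:R * ((n + n)`!)%:R.
have F1 : 1 <= F by rewrite /F -natrM ler1n muln_gt0 fact_gt0 addn_gt0 n0.
set pR := map_poly (intr : int -> R) p; set qR := map_poly (intr : int -> R) q.
have szpR : size pR = size p by rewrite size_map_inj_poly//; exact: intr_inj.
have szqR : size qR = size q by rewrite size_map_inj_poly//; exact: intr_inj.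
have res1 : 1 <= `|resultant pR qR|.
  rewrite resultant_map_inj; last exact: intr_inj.
  rewrite -intr_norm -abszE ler1n absz_gt0.
  exact: resultant_neq0_of_coprimep.
have coefH (r : {poly int}) k :
    `|(map_poly (intr : int -> R) r)`_k| <= (height r)%:R.
  by rewrite coef_map -intr_norm -abszE ler_nat leq_coef_height.
have dpn : ((size pR).-1 <= n)%N by rewrite szpR; case: (size p) szp.
have dqn : ((size qR).-1 <= n)%N by rewrite szqR; case: (size q) szq.
(* An empty Sylvester matrix has no column for the power [x ^+ 0]; but then [p] is a nonzero
   constant, and its value is its height. *)
have [m0|m0] := posnP ((size qR).-1 + (size pR).-1)%N.
  have {}szp : (size p <= 1)%N.
    move/eqP: m0; rewrite addn_eq0 szpR => /andP[_].
    by case: (size p) => [|[]].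
  rewrite /Lp evalz_const//.
  apply: mulr_ege1; first exact: mulr_ege1.
  by apply: mulr_ege1; [apply: mulr_ege1 => //|]; apply: exprn_ege1.
pose b (i : 'I_((size qR).-1 + (size pR).-1)) : R :=
  if fintype.split i is inl _ then Hp else Hq.
have b1 i : 1 <= b i by rewrite /b; case: fintype.split.
have b0 i : 0 <= b i := le_trans ler01 (b1 i).
have hS i j : `|Sylvester_mx pR qR i j| <= b i.
  rewrite Sylvester_mxE /b.
  by case: fintype.split => k; case: leqP => _;
    rewrite ?mulr1n ?mulr0n ?normr0 ?(le_trans ler01)//; apply: coefH.
have pw k : (k <= n)%N -> `|x| ^+ k <= T.
  move=> kn; apply: (@le_trans _ _ ((1 + `|x|) ^+ k)).
    by apply: lerXn2r; rewrite ?nnegrE ?addr_ge0// lerDr.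
  by apply: ler_weXn2l => //; rewrite lerDl.
have hv i : `|(Sylvester_mx pR qR *m \col_j x ^+ j) i 0| <= T * Lp / Hp * b i.
  rewrite Sylvester_mx_powers /b.
  have Hp0 : 0 < Hp := lt_le_trans ltr01 Hp1.
  case: fintype.split => k; rewrite normrM normrX.
    rewrite divfK ?gt_eqF// mulrC ler_pM ?normr_ge0 ?exprn_ge0//.
    exact/pw/ltnW/(leq_trans (ltn_ord k))/dqn.
  have lq : `|qR.[x]| <= Lp / Hp * Hq.
    rewrite (le_trans lqp)// -mulrA ler_peMr// mulrC ler_pdivlMr// mul1r.
    exact: Hpq.
  rewrite -!mulrA mulrC ler_pM ?normr_ge0 ?exprn_ge0 ?mulrA//.
  exact/pw/ltnW/(leq_trans (ltn_ord k))/dpn.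
have vj : (\col_(j < (size qR).-1 + (size pR).-1) x ^+ j) (Ordinal m0) 0 = 1.
  by rewrite mxE expr0.
apply: (le_trans res1).
have := norm_det_le_mulmx _ _ _ _ _ _ _ hS b0 vj hv.
have -> : \prod_i b i = Hp ^+ (size qR).-1 * Hq ^+ (size pR).-1.
  rewrite big_split_ord/= /b; congr (_ * _).
    under eq_bigr => i _ do rewrite (unsplitK (inl i)).
    by rewrite prodr_const card_ord.
  under eq_bigr => i _ do rewrite (unsplitK (inr i)).
  by rewrite prodr_const card_ord.
set m := ((size qR).-1 + (size pR).-1)%N.
have mn : (m <= n + n)%N by exact: leq_add.
have HpX : Hp ^+ (size qR).-1 / Hp <= Hp ^+ n.-1.
  rewrite ler_pdivrMr ?(lt_le_trans ltr01)// -exprSr prednK//.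
  by exact: ler_weXn2l.
have HqX : Hq ^+ (size pR).-1 <= Hq ^+ n.
  by exact: ler_weXn2l.
have Fm : (m * m`!)%:R <= F :> R.
  by rewrite /F -natrM ler_nat leq_mul// leq_fact.
have -> : T * Lp / Hp * (m * m`!)%:R * (Hp ^+ (size qR).-1 * Hq ^+ (size pR).-1)
  = (m * m`!)%:R * T * (Lp * (Hp ^+ (size qR).-1 / Hp) * Hq ^+ (size pR).-1).
  by ring.
move=> /le_trans; apply.
by rewrite !ler_pM ?mulr_ge0 ?exprn_ge0 ?invr_ge0 ?ler0n ?(le_trans ler01 T1).
Qed.

(** * Lattices spanned by consecutive best approximations *)

Lemma nearest_int_multiple (a m : int) : m != 0 ->
  exists c r : int, a = c * m + r /\ 2 * `|r| <= `|m|.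
Proof.
(* Rounding to the nearest: the Euclidean remainder equals [2 * r + |m|] and lies in
   [[0, 2 |m|)]. *)
move=> m0; exists ((2 * a + `|m|) %/ (2 * m))%Z.
exists (a - ((2 * a + `|m|) %/ (2 * m))%Z * m); split; first by ring.
have d0 : 2 * m != 0 by rewrite mulf_neq0.
have := divz_eq (2 * a + `|m|) (2 * m).
have := modz_ge0 (2 * a + `|m|) d0; have := ltz_mod (2 * a + `|m|) d0.
set c := (_ %/ _)%Z; set r := (_ %% _)%Z; rewrite normrM => r1 r0 E.
have -> : 2 * `|a - c * m| = `|2 * a - c * (2 * m)|.
  by rewrite (_ : 2 * a - c * (2 * m) = 2 * (a - c * m)) ?normrM//; ring.
have -> : 2 * a - c * (2 * m) = r - `|m|.
  by apply/eqP; rewrite subr_eq addrAC -subr_eq opprK E addrC.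
by rewrite ler_norml; apply/andP; split; move: r0 r1; rewrite ger0_norm//; lia.
Qed.

(** Serves twice for a reduced lattice point: over the integers for its coefficients, over the reals
    for its value. *)
Lemma norm_half_combination (R : realDomainType) (m r s x p q : R) :
  m != 0 -> 2 * `|r| <= `|m| -> 2 * `|s| <= `|m| -> m * x = r * p + s * q ->
  2 * `|x| <= `|p| + `|q|.
Proof.
move=> m0 hr hs E; rewrite -(@ler_pM2l _ `|m|) ?normr_gt0//.
rewrite mulrCA -normrM E mulrDr.
apply: (@le_trans _ _ (2 * (`|r| * `|p| + `|s| * `|q|))).
  by rewrite ler_wpM2l// -!normrM ler_normD.
by rewrite mulrDr !mulrA lerD// ler_wpM2r.
Qed.

Lemma absz_lt_of_double (a b c : int) (s t : nat) :
  2 * `|a|%R <= `|b| + `|c| -> (`|b| <= s)%N -> (`|c| <= t)%N -> (s < t)%N ->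
  (`|a| < t)%N.
Proof. lia. Qed.

(** [P k] competes in the minimization that defines [P k.+1]; a tie would give [P k.+1 = +- P k] by
    uniqueness, against the growth of heights. *)
Lemma best_approximations_evalz_lt (R : realType) (x : R) (n : nat)
    (P : nat -> {poly int}) (k : nat) :
  best_approximations x n P -> (0 < k)%N ->
  `|evalz (P k.+1) x| < `|evalz (P k) x|.
Proof.
move=> hP k0; have [[p0 sp] hlt _ _ _] := hP _ k0.
have [[q0 _] hlt1 _ hmin huniq] := hP k.+1 isT.
have hp : (height (P k) < height (P k.+2))%N := ltn_trans hlt hlt1.
rewrite lt_neqAle hmin// andbT; apply/eqP => E.
have [i hi] := height_attained _ q0.
have hle := leq_coef_height (P k) i; move: hlt; rewrite hi ltnNge.
by have [<-|Ek] := huniq _ (conj p0 sp) hp (esym E); rewrite ?hle//;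
  move: hle; rewrite Ek coefN abszN => ->.
Qed.

(* Reducing the two coefficients modulo [m] to at most [|m| / 2] leaves a
   polynomial of height below [height (P k.+1)] and smaller than [P k] at [x],
   which must vanish by minimality. *)
Lemma best_approximations_lattice (R : realType) (x : R) (n : nat)
    (P : nat -> {poly int}) (k : nat) (q : {poly int}) (m a b : int) :
  best_approximations x n P -> (0 < k)%N -> m != 0 ->
  m *: q = a *: P k + b *: P k.+1 ->
  exists c d : int, q = c *: P k + d *: P k.+1.
Proof.
move=> hP k0 m0 E.
have [c [r [aE hr]]] := nearest_int_multiple a m m0.
have [d [s [bE hs]]] := nearest_int_multiple b m m0.
exists c, d; apply/eqP; rewrite -subr_eq0; set y := _ - _.
have yE : m *: y = r *: P k + s *: P k.+1.
  rewrite /y scalerBr E aE bE scalerDr !scalerA !scalerDl [m * c]mulrC.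
  by rewrite [m * d]mulrC addrACA [X in X - _]addrC addrK.
apply/negPn/negP => y0.
have [[_ sp] hlt _ hmin _] := hP _ k0; have [[_ sq] _ _ _ _] := hP k.+1 isT.
have sy : (size y <= n.+1)%N.
  rewrite -(size_scale _ m0) yE (leq_trans (size_polyD _ _))// geq_max.
  by rewrite !(leq_trans (size_scale_leq _ _)).
have hy : (height y < height (P k.+1))%N.
  apply: height_lt => [|i]; first exact: leq_ltn_trans hlt.
  have h2 : 2 * `|y`_i| <= `|(P k)`_i| + `|(P k.+1)`_i|.
    apply: (norm_half_combination _ _ _ _ _ _ _ m0 hr hs).
    by rewrite -!coefZ -coefD yE.
  exact: (absz_lt_of_double _ _ _ _ _ h2 (leq_coef_height _ _)
    (leq_coef_height _ _) hlt).
have := hmin _ (conj y0 sy) hy.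
have mR (u : int) : 2 * `|u| <= `|m| -> 2 * `|u%:~R| <= `|m%:~R| :> R.
  by move=> h; rewrite -!intr_norm -(intrM _ 2) ler_int.
have mR0 : m%:~R != 0 :> R by rewrite intr_eq0.
have /(norm_half_combination _ _ _ _ _ _ _ mR0 (mR _ hr) (mR _ hs)) :
    m%:~R * evalz y x = r%:~R * evalz (P k) x + s%:~R * evalz (P k.+1) x.
  by rewrite -!evalzZ -evalzD yE.
have := best_approximations_evalz_lt _ _ _ _ _ hP k0.
lra.
Qed.

(** Heights increase while values decrease: in [b P_(k+1) = - a P_k] with [b] nonzero, the values
    give [|a| < |b|], and then the heights cannot match. *)
Lemma best_approximations_free (R : realType) (x : R) (n : nat)
    (P : nat -> {poly int}) (k : nat) (a b : int) :
  best_approximations x n P -> (0 < k)%N ->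
  a *: P k + b *: P k.+1 = 0 -> a = 0 /\ b = 0.
Proof.
move=> hP k0 E.
have [[p0 _] hlt L0 _ _] := hP _ k0; have [[q0 _] _ _ _ _] := hP k.+1 isT.
have [b0|b0] := eqVneq b 0.
  move: E; rewrite b0 scale0r addr0 => /eqP.
  by rewrite scale_poly_eq0 (negPf p0) orbF => /eqP.
exfalso; have {}E : b *: P k.+1 = (- a) *: P k.
  by apply/eqP; rewrite scaleNr -addr_eq0 addrC E.
have Le : `|b%:~R| * `|evalz (P k.+1) x| = `|a%:~R| * `|evalz (P k) x|.
  by rewrite -!normrM -!evalzZ E evalzZ evalzZ rmorphN mulNr normrN.
have [i hi] := height_attained _ q0.
have He : (`|b| * height (P k.+1) = `|a| * `|((P k)`_i)%R|)%N.
  by rewrite hi -!abszM -coefZ E coefZ mulNr abszN.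
have hb : (0 < `|b|)%N by rewrite absz_gt0.
have hab : (`|a| < `|b|)%N.
  rewrite -(ltr_nat R) !natr_absz !intr_norm.
  rewrite -(@ltr_pM2r _ `|evalz (P k) x|)// -Le ltr_pM2l ?normr_gt0 ?intr_eq0//.
  exact: best_approximations_evalz_lt hP k0.
suff : (`|b| * height (P k.+1) < `|b| * height (P k.+1))%N by rewrite ltnn.
rewrite {1}He.
apply: (leq_ltn_trans (leq_mul (ltnW hab) (leq_coef_height (P k) i))).
by rewrite ltn_pmul2l.
Qed.

(* Both consecutive pairs are bases of the same rank two lattice, so the
   coefficient of [P k.+2] in the expansion of [P k] is a unit. *)
Lemma dependent_best_approximations (R : realType) (x : R) (n : nat)
    (P : nat -> {poly int}) (k : nat) (a b c : int) :
  best_approximations x n P -> (0 < k)%N ->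
  a *: P k + b *: P k.+1 + c *: P k.+2 = 0 -> [|| a != 0, b != 0 | c != 0] ->
  `|evalz (P k) x| * (height (P k.+1))%:R <=
  3 * (`|evalz (P k.+1) x| * (height (P k.+2))%:R).
Proof.
move=> hP k0 E abc.
have c0 : c != 0.
  apply/eqP => c0; move: E abc; rewrite c0 scale0r addr0.
  move=> /(best_approximations_free _ _ _ _ _ _ _ hP k0)[-> ->].
  by rewrite eqxx.
have a0 : a != 0.
  apply/eqP => a0; move: E abc; rewrite a0 scale0r add0r.
  move=> /(best_approximations_free _ _ _ _ _ _ _ hP (isT : 0 < k.+1)%N)[-> ->].
  by rewrite eqxx.
have [s [t E1]] : exists s t : int, P k.+2 = s *: P k + t *: P k.+1.
  apply: (best_approximations_lattice _ _ _ _ _ _ c (- a) (- b) hP k0 c0).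
  by apply/eqP; rewrite !scaleNr -opprD -addr_eq0 addrC E.
have [u [v E2]] : exists u v : int, P k = u *: P k.+1 + v *: P k.+2.
  apply: (best_approximations_lattice _ _ _ _ k.+1 _ a (- b) (- c) hP isT a0).
  by apply/eqP; rewrite !scaleNr -opprD -addr_eq0 addrA E.
have vs : v * s = 1.
  have : (v * s - 1) *: P k + (u + v * t) *: P k.+1 = 0.
    have E3 : P k = u *: P k.+1 + ((v * s) *: P k + (v * t) *: P k.+1).
      by rewrite {1}E2 E1 scalerDr !scalerA.
    apply/eqP; rewrite scalerBl scale1r scalerDl addrAC subr_eq0 addrCA.
    by rewrite -E3.
  move=> /(best_approximations_free _ _ _ _ _ _ _ hP k0)[/eqP].
  by rewrite subr_eq0 => /eqP.
have v1 : `|v|%N = 1%N.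
  by have /eqP := congr1 absz vs; rewrite abszM muln_eq1 => /andP[/eqP].
have [[q0 _] hlt1 _ _ _] := hP k.+1 isT; have [_ hlt _ _ _] := hP k k0.
have [i hi] := height_attained _ q0.
(* Read off at a coefficient attaining the height of [P k.+1]. In the final constant 3, the term
   [u P_(k+1)] accounts for 2 and [v P_(k+2)] for 1. *)
have hu : (`|u| * height (P k.+1) <= 2 * height (P k.+2))%N.
  have : u * (P k.+1)`_i = (P k)`_i - v * (P k.+2)`_i.
    by rewrite -!coefZ -coefB [in RHS]E2 addrK.
  move/(congr1 absz); rewrite abszM -hi => ->.
  have absz_subr (s' t' : int) : (`|s' - t'| <= `|s'| + `|t'|)%N by clear; lia.
  have := absz_subr (P k)`_i (v * (P k.+2)`_i).
  rewrite abszM v1 mul1n; move/leq_trans; apply; rewrite mul2n -addnn leq_add//.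
    by rewrite (leq_trans (leq_coef_height _ _))// ltnW// (ltn_trans hlt).
  exact: leq_coef_height.
have hL : `|evalz (P k) x| <=
    `|u%:~R| * `|evalz (P k.+1) x| + `|evalz (P k.+2) x|.
  rewrite {1}E2 evalzD !evalzZ (le_trans (ler_normD _ _))// !normrM lerD2l.
  by rewrite -[`|v%:~R|]intr_norm -abszE v1 mul1r.
have hd : `|evalz (P k.+2) x| <= `|evalz (P k.+1) x|.
  exact/ltW/(best_approximations_evalz_lt _ _ _ _ k.+1 hP isT).
have {}hu : `|u%:~R| * (height (P k.+1))%:R <= 2 * (height (P k.+2))%:R :> R.
  by rewrite -intr_norm -abszE -!natrM ler_nat.
have hH : (height (P k.+1))%:R <= (height (P k.+2))%:R :> R.
  by rewrite ler_nat ltnW.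
apply: (le_trans (ler_wpM2r (ler0n _ _) hL)); rewrite mulrDl.
have h1 : `|u%:~R| * `|evalz (P k.+1) x| * (height (P k.+1))%:R <=
    2 * (`|evalz (P k.+1) x| * (height (P k.+2))%:R).
  by rewrite mulrAC [leLHS]mulrC [leRHS]mulrCA ler_wpM2l.
have := ler_pM (normr_ge0 _) (ler0n _ _) hd hH.
lra.
Qed.

(** Clears denominators: the relation is multiplied by the product [D] of the three denominators. *)
Lemma ratpoly_relation (p q r : {poly int}) (u v w : rat) :
  u *: ratpoly p + v *: ratpoly q + w *: ratpoly r = 0 ->
  [|| u != 0, v != 0 | w != 0] ->
  exists a b c : int,
    a *: p + b *: q + c *: r = 0 /\ [|| a != 0, b != 0 | c != 0].
Proof.
move=> E nz; exists (numq u * (denq v * denq w)),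
  (numq v * (denq u * denq w)), (numq w * (denq u * denq v)); split; last first.
  by rewrite !mulf_eq0 !numq_eq0 !(negPf (denq_neq0 _)) !orbF.
apply: (@map_inj_poly _ _ (intr : int -> rat)); [exact: intr_inj|by rewrite mulr0z|].
rewrite !rmorphD /= !map_polyZ rmorph0 /= !intrM !numqE.
pose D : rat := (denq u)%:~R * (denq v)%:~R * (denq w)%:~R.
rewrite (_ : u * _ * _ = D * u); last by rewrite /D; ring.
rewrite (_ : v * _ * _ = D * v); last by rewrite /D; ring.
rewrite (_ : w * _ * _ = D * w); last by rewrite /D; ring.
by rewrite -!scalerA -!scalerDr [X in _ *: (_ *: (_ *: X))]E !scaler0.
Qed.

(** * The uniform exponent *)

(** The exponent 0 is admissible, since [p] itself serves for all large [X]. If the set has no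
    supremum, [sup] takes its default value 0. *)
Lemma what_ge0 (R : realType) (x : R) (n : nat) (p : {poly int}) :
  intpoly n p -> 0 < `|evalz p x| < 1 -> 0 <= what n x.
Proof.
move=> pn /andP[p0 p1]; rewrite /what; set S := [set w : R | _].
have [[_ ub]|nS] := pselect (has_sup S); last by rewrite sup_out.
apply: ub_le_sup => //.
have : \forall X \near +oo, (height p)%:R <= X :> R.
  by apply: nbhs_pinfty_ge; apply: num_real.
by apply: filterS => X pX; exists p; split => //; rewrite oppr0 powRr0 p0.
Qed.

Lemma leq_best_approximations_height (R : realType) (x : R) (n : nat)
    (P : nat -> {poly int}) (k : nat) :
  best_approximations x n P -> (k <= height (P k))%N.
Proof.
move=> hP; elim: k => // -[_|k ih].
  by have [[p0 _] _ _ _ _] := hP 1%N isT; apply: height_gt0.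
by have [_ hlt _ _ _] := hP k.+1 isT; apply: leq_ltn_trans hlt.
Qed.

(** The definition of the exponent is applied at [X = H_(k+1) / 2]: the polynomial it provides has
    height below [H_(k+1)], so [P k] is at least as small at [x]. Halving costs the [ln 2]. *)
Lemma best_approximations_what (R : realType) (x : R) (n : nat)
    (P : nat -> {poly int}) (v : R) :
  best_approximations x n P -> 0 < v < what n x ->
  exists K : nat, forall k : nat, (0 < k)%N -> (K <= k)%N ->
    v * (ln (height (P k.+1))%:R - ln 2) <= - ln `|evalz (P k) x|.
Proof.
move=> hP /andP[v0]; rewrite /what; set S := [set w : R | _] => vS.
(* Without a supremum the default value 0 contradicts [0 < v]. *)
have [hS|nS] := pselect (has_sup S); last by move: vS; rewrite sup_out//; lra.
have [e Se ve] := @sup_adherent _ S _ (etrans (subr_gt0 _ _) vS) hS.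
have {}ve : v < e by lra.
have [M [_ hM]] := Se.
(* Since heights are at least their index, [H / 2] exceeds both [M] and 1. *)
exists (Num.truncn (2 * (1 + `|M|))).+1 => k k0 Kk.
have [[p0 _] hlt L0 hmin _] := hP _ k0.
set H : R := (height (P k.+1))%:R.
have HM : 2 * (1 + `|M|) < H.
  apply: lt_le_trans (truncnS_gt _) _; rewrite ler_nat (leq_trans Kk)//.
  exact/(leq_trans (leq_best_approximations_height _ _ _ _ _ hP))/ltnW.
have MM : M <= `|M| := ler_norm M.
have M0 : 0 <= `|M| := normr_ge0 M.
have MH : M < H / 2 by lra.
have H21 : 1 < H / 2 by lra.
have [p [pn pX /andP[px0 px]]] := hM _ MH.
have ph : (height p < height (P k.+1))%N by rewrite -(ltr_nat R) -/H; lra.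
have {ph} /le_lt_trans/(_ px) L := hmin _ pn ph.
have Xpos : 0 < (H / 2) `^ (- e) by apply: powR_gt0; lra.
move: L; rewrite -ltr_ln ?posrE// ln_powR ln_div ?posrE; [|lra|lra].
have : 0 <= ln (H / 2) by apply: ln_ge0; lra.
rewrite ln_div ?posrE; [|lra|lra].
nra.
Qed.

(** * Real inequalities excluding either condition *)

(* In the next three lemmas [N] is the degree bound, [h], [h1], [h2] are the
   logarithms of three consecutive heights, and [c], [d] absorb the constants
   of the resultant bound and of the lattice and uniform exponent bounds. *)
Lemma tau_condition_false (R : realFieldType) (N nu nu1 h h1 h2 c d : R) :
  2 <= N -> 0 < h -> 0 < h1 -> 0 <= c -> 2 * N - 1 < nu ->
  nu * h <= c + (N - 1) * h + N * h1 -> nu1 * h1 - h2 <= nu * h - h1 + d ->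
  d + 2 * c < h1 -> ~ N < (nu1 - h2 / h1) * ((nu - N + 1) / nu).
Proof.
move=> N2 h0 h10 c0 hnu A C big cond.
have nu0 : 0 < nu by lra.
have m0 : 0 < nu - N + 1 by lra.
have e1 : N * (nu * h1) < (nu1 * h1 - h2) * (nu - N + 1).
  have -> : (nu1 * h1 - h2) * (nu - N + 1) =
      (nu1 - h2 / h1) * ((nu - N + 1) / nu) * (nu * h1).
    by field; rewrite !gt_eqF.
  by rewrite ltr_pM2r// mulr_gt0.
have e2 : (nu1 * h1 - h2) * (nu - N + 1) <= (nu * h - h1 + d) * (nu - N + 1).
  by rewrite ler_pM2r.
have e3 : nu * (nu * h) <= nu * (c + (N - 1) * h + N * h1) by rewrite ler_pM2l.
(* Here [nu > 2 N - 1] enters: it makes [nu - N + 1] exceed [nu / 2], so the gain from [h1 - d]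
   outweighs the error [nu * c]. *)
have e4 : nu / 2 * (h1 - d) <= (nu - N + 1) * (h1 - d).
  by rewrite ler_wpM2r; lra.
have e5 : 0 < nu * (h1 - d - 2 * c) by rewrite mulr_gt0//; lra.
nra.
Qed.

(** If [w <= 1], the only positive term [chi^2 nu1 w^2] is at most [chi nu nu1], because
    [chi <= nu]. *)
Lemma what_condition_gt1 (R : realFieldType) (N nu nu1 w : R) :
  2 <= N -> 2 * N - 1 < nu -> 0 <= nu1 -> 0 <= w ->
  let chi := (nu - N + 1) / N in
  0 < (chi ^+ 2 * nu1 - chi * nu) * w ^+ 2 - nu * w - chi * nu * nu1 -> 1 < w.
Proof.
move=> N2 hnu nu10 w0 chi cond; rewrite ltNge; apply/negP => w1.
have chi1 : 1 < chi by rewrite /chi ltr_pdivlMr; lra.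
have nuE : nu = N * chi + N - 1 by rewrite /chi; field; rewrite gt_eqF//; lra.
have chinu : chi <= nu by nra.
have w21 : w ^+ 2 <= 1 by rewrite expr_le1.
have w20 : 0 <= w ^+ 2 by rewrite sqr_ge0.
have t1 : 0 <= nu * w by rewrite mulr_ge0//; lra.
have t2 : 0 <= chi * nu * w ^+ 2 by rewrite mulr_ge0// mulr_ge0; lra.
have t3 : chi * (chi * nu1 * w ^+ 2) <= chi * (nu * nu1).
  rewrite ler_pM2l; last lra.
  rewrite -[leRHS]mulr1; apply: ler_pM => //; last exact: ler_wpM2r.
  by rewrite mulr_ge0//; lra.
nra.
Qed.

Lemma what_condition_false (R : realFieldType) (N nu nu1 h h1 h2 c d w : R) :
  2 <= N -> 0 < h -> 0 < h1 -> 0 <= c -> 2 * N - 1 < nu -> 0 <= nu1 ->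
  nu * h <= c + (N - 1) * h + N * h1 -> nu1 * h1 - h2 <= nu * h - h1 + d ->
  1 < w ->
  h2 <= (w^-1 + (1 - w^-1) * w^-1 ^+ 2 / (8 * N)) * (nu1 * h1) + d ->
  2 * N * c + 2 * d < w^-1 ^+ 2 / 2 * h1 ->
  let chi := (nu - N + 1) / N in
  ~ 0 < (chi ^+ 2 * nu1 - chi * nu) * w ^+ 2 - nu * w - chi * nu * nu1.
Proof.
move=> N2 h0 h10 c0 hnu nu10 A C w1.
have wE : w = w^-1^-1 by rewrite invrK.
have : 0 < w^-1 < 1 by rewrite invr_gt0 invf_lt1; lra.
move: wE; set u := w^-1 => -> /andP[u0 u1].
set eta := (1 - u) * u ^+ 2 / (8 * N) => B big chi cond.
have chi1 : 1 < chi by rewrite /chi ltr_pdivlMr; lra.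
have nuE : nu = N * chi + N - 1 by rewrite /chi; field; rewrite gt_eqF//; lra.
(* Here [r = nu / chi], written through [nu = N chi + N - 1]; as [0 < s < 1], it lies between [N]
   and [2 N - 1]. *)
pose s := chi^-1; pose r := N + (N - 1) * s.
have s01 : 0 < s < 1 by rewrite invr_gt0 invf_lt1; lra.
move/andP: s01 => [s0 s1].
have nur : nu = r * chi.
  by rewrite nuE /r /s; field; rewrite gt_eqF//; lra.
have rN : N <= r by rewrite lerDl mulr_ge0//; lra.
have r2 : r <= 2 * N - 1.
  by rewrite /r; nra.
(* The resultant bound after removing [(N - 1) h] and dividing by [N]. *)
have chih : chi * h <= c + h1.
  have : N * (chi * h) <= N * (c + h1).
    have : nu * h = N * (chi * h) + (N - 1) * h by rewrite nuE; ring.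
    nra.
  by rewrite ler_pM2l//; lra.
(* The assumed condition divided by [(chi / u)^2]. *)
have key : nu1 * (1 - r * u ^+ 2) > r + r * s * u.
  have : 0 < (nu1 * (1 - r * u ^+ 2) - (r + r * s * u)) * (chi / u) ^+ 2.
    suff -> : (nu1 * (1 - r * u ^+ 2) - (r + r * s * u)) * (chi / u) ^+ 2 =
      (chi ^+ 2 * nu1 - chi * nu) * u^-1 ^+ 2 - nu / u - chi * nu * nu1 by [].
    rewrite nur /s; field.
    by rewrite !gt_eqF//; lra.
  by rewrite pmulr_lgt0 ?subr_gt0// exprn_gt0// divr_gt0//; lra.
have g0 : 0 < 1 - r * u ^+ 2.
  have rp : 0 < r + r * s * u by rewrite addr_gt0 ?mulr_gt0//; lra.
  rewrite ltNge; apply/negP => g.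
  by have := mulr_ge0_le0 nu10 g; lra.
(* The gap [u ^+ 2] comes from [3/4 r^2 - r - 1 >= 0] for [r >= 2]. *)
have lower : r - 1 + u ^+ 2 < nu1 * (1 - u).
  rewrite -(ltr_pM2r g0).
  apply: (@le_lt_trans _ _ ((r + r * s * u) * (1 - u))); last first.
    by rewrite [ltRHS]mulrAC ltr_pM2r//; lra.
  have h3 : 0 <= r * s * u * (1 - u) by rewrite !mulr_ge0//; lra.
  have h4 : 0 <= (1 - r * u / 2) ^+ 2 by rewrite sqr_ge0.
  have h5 : 0 <= u ^+ 2 * ((r - 2) * (3 / 4 * r + 1 / 2)).
    by rewrite mulr_ge0 ?sqr_ge0// mulr_ge0//; lra.
  have h6 : 0 <= r * (u ^+ 2) ^+ 2 by rewrite mulr_ge0 ?sqr_ge0//; lra.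
  nra.
(* The constants [c] and [d] use up half of the gap [u ^+ 2]; the other half is left for
   [eta * nu1]. *)
have upper : nu1 * (1 - u - eta) <= r - 1 + u ^+ 2 / 2.
  rewrite -(ler_pM2r h10).
  have : nu * h <= r * (c + h1) by rewrite nur -mulrA ler_pM2l//; lra.
  nra.
have eta0 : 0 < eta by rewrite divr_gt0 ?mulr_gt0 ?exprn_gt0//; lra.
have etaE : 8 * N * eta = (1 - u) * u ^+ 2.
  by rewrite /eta; field; rewrite gt_eqF//; lra.
have u21 : u ^+ 2 <= 1 by rewrite expr_le1//; lra.
have etau : eta <= (1 - u) / 2.
  have : 0 <= (8 * N - 16) * eta by rewrite mulr_ge0//; lra.
  have : (1 - u) * u ^+ 2 <= (1 - u) * 1 by rewrite ler_wpM2l//; lra.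
  lra.
(* This crude consequence of [upper] explains the factor [8 * N] in [eta]. *)
have nu1le : nu1 * (1 - u) <= 4 * N.
  have : 0 <= nu1 * ((1 - u) / 2 - eta) by rewrite mulr_ge0//; lra.
  by nra.
have : eta * nu1 <= u ^+ 2 / 2.
  have : 8 * N * (eta * nu1) <= 8 * N * (u ^+ 2 / 2).
    rewrite mulrA etaE mulrAC [leRHS](_ : _ = 4 * N * u ^+ 2); last by field.
    by rewrite ler_wpM2r ?sqr_ge0// mulrC.
  by rewrite ler_pM2l//; lra.
nra.
Qed.

(** * Choice of the threshold index and passage to logarithms *)

Theorem theorem4p15 (R : realType) (theta : R) (n : nat)
    (P : nat -> {poly int}) :
  transcendental theta -> (2 <= n)%N -> best_approximations theta n P ->
  exists K : nat, forall k : nat, (0 < k)%N -> (K <= k)%N ->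
    coprimep (ratpoly (P k)) (ratpoly (P k.+1)) ->
    let nu_k := nu theta (P k) in
    let nu_k1 := nu theta (P k.+1) in
    let tau_k1 := tau R P k.+1 in
    let chi_k := (nu_k - n%:R + 1) / n%:R in
    let w := what n theta in
    2 * n%:R - 1 < nu_k ->
    (0 < (chi_k ^+ 2 * nu_k1 - chi_k * nu_k) * w ^+ 2
           - nu_k * w - chi_k * nu_k * nu_k1 \/
     n%:R < (nu_k1 - tau_k1) * ((nu_k - n%:R + 1) / nu_k)) ->
    linearly_independent (fun i : 'I_3 => ratpoly (P (k + i)%N)).
Proof.
move=> _ n2 hP.
have [C C1 hC] : exists2 C : R, 1 <= C & forall k, (0 < k)%N ->
    coprimep (ratpoly (P k)) (ratpoly (P k.+1)) ->
    1 <= C * (`|evalz (P k) theta| * (height (P k))%:R ^+ n.-1 *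
              (height (P k.+1))%:R ^+ n).
  exists ((n + n)%:R * ((n + n)`!)%:R * (1 + `|theta|) ^+ n).
    rewrite mulr_ege1 ?exprn_ege1 ?lerDl//.
    by rewrite -natrM ler1n muln_gt0 fact_gt0 andbT; lia.
  move=> k k0 hcop; have [pn hlt _ _ _] := hP k k0.
  have [qn _ _ _ _] := hP k.+1 isT.
  apply: resultant_lower_bound (ltnW hlt) _ => //; first exact: ltnW.
  exact/ltW/(best_approximations_evalz_lt _ _ _ _ _ hP k0).
(* [ln 3] is the loss in the lattice bound, [ln 2] the loss in the uniform exponent bound. *)
pose c := ln C; pose d : R := ln 2 + ln 3.
have c0 : 0 <= c by apply: ln_ge0.
have ln20 : 0 <= ln 2 :> R by apply: ln_ge0; lra.
have ln30 : 0 <= ln 3 :> R by apply: ln_ge0; lra.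
have N2 : 2 <= n%:R :> R by rewrite ler_nat.
pose w := what n theta.
(* Slightly above [1 / w], so that [u^-1] is strictly below the uniform exponent. *)
pose u := w^-1 + (1 - w^-1) * w^-1 ^+ 2 / (8 * n%:R).
have uw : 1 < w -> 0 < w^-1 < u.
  move=> w1; have w0 : 0 < w := lt_trans ltr01 w1.
  have iw1 : 0 < 1 - w^-1 by rewrite subr_gt0 invf_lt1.
  by rewrite invr_gt0 w0 ltrDl divr_gt0 ?mulr_gt0 ?exprn_gt0 ?invr_gt0//; lra.
(* The threshold is fixed before the condition, which yields [1 < w], is available; hence [1 < w]
   stays a premise. *)
have [K1 hK1] : exists K1 : nat, 1 < w -> forall k : nat,
    (0 < k)%N -> (K1 <= k)%N ->
    u^-1 * (ln (height (P k.+1))%:R - ln 2) <= - ln `|evalz (P k) theta|.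
  have [w1|w1] := ltP 1 w; last by exists 0%N => w1'; lra.
  have [K1 hK1] : exists K : nat, forall k : nat, (0 < k)%N -> (K <= k)%N ->
      u^-1 * (ln (height (P k.+1))%:R - ln 2) <= - ln `|evalz (P k) theta|.
    apply: (best_approximations_what _ _ _ _ _ hP).
    have /andP[iw0 iwu] := uw w1; have u0 := lt_trans iw0 iwu.
    by rewrite invr_gt0 u0 /= -[ltRHS]invrK ltf_pV2.
  by exists K1.
(* The sum of the lower bounds on [ln H_(k+1)] required in the two cases. *)
pose B : R := d + 2 * c + (2 * n%:R * c + 2 * d) * (2 * w ^+ 2).
exists (maxn (maxn K1 2) (Num.truncn (expR B)).+1) => k k0.
rewrite !geq_max => /andP[/andP[hk1 hk2] hkB] hcop nu_k nu_k1 tau_k1 chi_k w' hnu.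
move=> cond a hsum; apply: contrapT => /existsNP[i /eqP ai].
have [pn hlt L0 _ _] := hP k k0.
have [_ hlt1 L1 _ _] := hP k.+1 isT.
have Lle := ltW (best_approximations_evalz_lt _ _ _ _ _ hP k0).
have kH := leq_best_approximations_height _ _ _ _ k hP.
have dep : `|evalz (P k) theta| * (height (P k.+1))%:R <=
    3 * (`|evalz (P k.+1) theta| * (height (P k.+2))%:R).
  move: hsum; rewrite !big_ord_recl big_ord0 /= addr0 addn0 addn1 addn2 addrA.
  move=> /ratpoly_relation[|a0 [a1 [a2 [E nz]]]].
    apply: contraT; rewrite !negb_or !negbK => /and3P[/eqP z0 /eqP z1 /eqP z2].
    move: ai; rewrite -[_ != _]/(~~ (_ == _)).
    suff -> : a i = 0 by rewrite eqxx.
    by case: i => [[|[|[|//]]] hi]; [rewrite -[RHS]z0|rewrite -[RHS]z1|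
      rewrite -[RHS]z2]; congr a; apply: val_inj.
  exact: (dependent_best_approximations _ _ _ _ _ _ _ _ hP k0 E nz).
have res := hC k k0 hcop.
have Hk : 2 <= (height (P k))%:R :> R by rewrite ler_nat (leq_trans hk2).
have Hk1 : (height (P k))%:R < (height (P k.+1))%:R :> R by rewrite ltr_nat.
have Hk2 : (height (P k.+1))%:R < (height (P k.+2))%:R :> R by rewrite ltr_nat.
have hB : B < ln (height (P k.+1))%:R.
  rewrite -ltr_expR lnK ?posrE; last lra.
  apply: lt_trans (truncnS_gt _) _; rewrite ltr_nat.
  exact: leq_ltn_trans (leq_trans hkB kH) hlt.
(* Index [k.+1] is the one that bounds [H_(k+2)] through the value of [P k.+1]. *)
move: hK1 => /(_ _ k.+1 isT (leqW hk1)) hK1.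
move: hnu cond hK1 res dep L0 L1 Lle Hk Hk1 Hk2 hB.
rewrite /nu_k /nu_k1 /tau_k1 /chi_k /nu /tau.
set H := (height (P k))%:R; set H1 := (height (P k.+1))%:R.
set H2 := (height (P k.+2))%:R; set L := `|evalz (P k) theta|.
set L1 := `|evalz (P k.+1) theta|.
move=> hnu cond hK1 res dep L0 L10 Lle Hk Hk1 Hk2 hB.
have Hpos : 0 < H by lra.
have H1pos : 0 < H1 by lra.
have H2pos : 0 < H2 by lra.
have h0 : 0 < ln H by apply: ln_gt0; lra.
have h1 : ln H < ln H1 by rewrite ltr_ln ?posrE.
set v := - (ln L / ln H) in hnu cond; set v1 := - (ln L1 / ln H1) in cond.
have vE : v * ln H = - ln L by rewrite /v mulNr divfK// gt_eqF.
have v1E : v1 * ln H1 = - ln L1.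
  by rewrite /v1 mulNr divfK// gt_eqF// (lt_trans h0).
have Lln : ln L1 <= ln L by rewrite ler_ln ?posrE.
have v0 : 0 < v by lra.
(* Positivity of [nu_k] forces [L < 1]; hence also [L1 < 1], and [nu_(k+1)] is nonnegative. *)
have L_lt1 : ln L < 0 by have := mulr_gt0 v0 h0; lra.
have v10 : 0 <= v1.
  by rewrite -(pmulr_lge0 _ (lt_trans h0 h1)) v1E; lra.
have resln : v * ln H <= c + (n%:R - 1) * ln H + n%:R * ln H1.
  have lnX : ln (H ^+ n.-1) = (n%:R - 1) * ln H.
    have -> : n%:R - 1 = n.-1%:R :> R.
      by case: (n) n2 => // m _; rewrite -natr1 addrK.
    by rewrite lnXn// mulr_natl.
  have lnX1 : ln (H1 ^+ n) = n%:R * ln H1 by rewrite lnXn// mulr_natl.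
  have Cpos : 0 < C := lt_le_trans ltr01 C1.
  move: res; rewrite -ler_ln ?posrE ?mulr_gt0 ?exprn_gt0//.
  rewrite ln1 !lnM ?posrE ?mulr_gt0 ?exprn_gt0// lnX lnX1 vE -/c; lra.
have depln : v1 * ln H1 - ln H2 <= v * ln H - ln H1 + d.
  move: dep; rewrite -ler_ln ?posrE ?mulr_gt0//.
  rewrite !lnM ?posrE ?mulr_gt0//.
  rewrite vE v1E /d; lra.
have d0 : 0 <= d by rewrite addr_ge0.
have sq0 : 0 <= (2 * n%:R * c + 2 * d) * (2 * w ^+ 2).
  have ge0 (s t : R) : 0 <= s -> 0 <= t -> 0 <= 2 * n%:R * s + 2 * t.
    by move=> s0 t0; rewrite addr_ge0 ?mulr_ge0.
  by rewrite mulr_ge0 ?ge0// mulr_ge0 ?sqr_ge0.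
have hB1 : d + 2 * c < ln H1 by rewrite /B in hB; lra.
have h10 : 0 < ln H1 := lt_trans h0 h1.
case: cond => cond; last first.
  exact: (tau_condition_false _ _ _ _ _ _ _ _ _ N2 h0 h10 c0 hnu resln depln hB1 cond).
have L_lt1' : L < 1 by rewrite -ltr_ln ?posrE// ln1.
have w0 : 0 <= w by apply: (what_ge0 _ _ _ (P k)) => //; rewrite L0.
have w1 := what_condition_gt1 _ _ _ _ _ N2 hnu v10 w0 cond.
have {}hK1 := hK1 w1.
have /andP[iw0 iwu] := uw w1; have u0 := lt_trans iw0 iwu.
apply: (what_condition_false _ _ _ _ _ _ _ c d w N2 h0 h10 c0 hnu v10 resln depln w1 _ _ cond).
  rewrite -/u v1E; move: hK1; rewrite ler_pdivrMl// /d; lra.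
have -> : w^-1 ^+ 2 / 2 * ln H1 = ln H1 / (2 * w ^+ 2).
  by field; rewrite gt_eqF// (lt_trans ltr01).
rewrite ltr_pdivlMr; first by rewrite /B in hB; lra.
by rewrite mulr_gt0 ?exprn_gt0// (lt_trans ltr01).
Qed.
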